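(* Let $\mathbb{K}=(K,+,0)$ be a positive commutative monoid. The following are equivalent: (1) $\mathbb{K}$ has the transportation property; (2) the inner consistency property holds for $\mathbb{K}$-relations; (3) every acyclic hypergraph has the local-to-global consistency property for $\mathbb{K}$-relations; (4) the hypergraph $P_3$ with vertices $A,B,C,D$ and hyperedges $\{A,B\},\{B,C\},\{C,D\}$ has the local-to-global consistency property for $\mathbb{K}$-relations.
   Context: A commutative monoid is positive if $p+q=0$ implies $p=q=0$; monoids have at least two elements. Attributes have domains; for a finite attribute set $X$, an $X$-tuple assigns each $A\in X$ a value in its domain; $t[Y]$ is restriction. A $\mathbb{K}$-relation over $X$ is a function $R$ from $X$-tuples to $K$ with finite support $R'=\{t:R(t)\ne0\}$; marginals $R[Y](t)=\sum_{r\in R',r[Y]=t}R(r)$. $R(X)$ and $S(Y)$ are consistent if some $\mathbb{K}$-relation $W$ over $X\cup Y$ has $W[X]=R$, $W[Y]=S$; they are inner consistent if $R[X\cap Y]=S[X\cap Y]$. The inner consistency property holds for $\mathbb{K}$-relations if any two inner consistent $\mathbb{K}$-relations are consistent. $\mathbb{K}$ has the transportation property if for all positive integers $m,n$ and all $b\in K^m$, $c\in K^n$ with $b_1+\dots+b_m=c_1+\dots+c_n$ there is $(d_{ij})\in K^{m\times n}$ with $\sum_j d_{ij}=b_i$ for all $i$ and $\sum_i d_{ij}=c_j$ for all $j$. A hypergraph with hyperedges $X_1,\dots,X_m$ has the local-to-global consistency property for $\mathbb{K}$-relations if every collection $R_1(X_1),\dots,R_m(X_m)$ that is pairwise consistent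 (every two are consistent) is globally consistent (some $W$ over $X_1\cup\dots\cup X_m$ has $W[X_i]=R_i$ for all $i$). A hypergraph is acyclic (Beeri–Fagin–Maier–Yannakakis) iff it has a join tree: a tree on its hyperedges such that for each vertex the hyperedges containing it form a connected subtree. *)

(* Defs.v *)
From HB Require Import structures.
From mathcomp Require Import all_boot all_order all_algebra.
From mathcomp Require Import finmap.
Set Implicit Arguments. Unset Strict Implicit. Unset Printing Implicit Defensive.
Import GRing.Theory.
Local Open Scope fset_scope.
Local Open Scope ring_scope.

Definition positive_monoid (K : nmodType) : Prop :=
  forall p q : K, p + q = 0 -> p = 0 /\ q = 0.

(* monoids have at least two elements *)
Definition nontrivial_monoid (K : nmodType) : Prop := exists x : K, x <> 0.

Definition transportation_property (K : nmodType) : Prop :=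
  forall (m n : nat), (0 < m)%N -> (0 < n)%N ->
  forall (b : 'I_m -> K) (c : 'I_n -> K),
    \sum_(i < m) b i = \sum_(j < n) c j ->
    exists d : 'I_m -> 'I_n -> K,
      (forall i, \sum_(j < n) d i j = b i) /\ (forall j, \sum_(i < m) d i j = c j).

(* A schema: a type of attributes [Att], each attribute [a] with domain [Dom a]. *)
Section Relations.
Variables (Att : choiceType) (Dom : Att -> choiceType) (K : nmodType).

Definition tup (X : {fset Att}) := {dffun forall a : X, Dom (val a)}.

Definition krel (X : {fset Att}) := {fsfun tup X -> K with 0}.

Definition restr (X Y : {fset Att}) (h : Y `<=` X) (t : tup X) : tup Y :=
  [ffun y : Y => t (fincl h y)].

Definition marg (X Y : {fset Att}) (R : krel X) (h : Y `<=` X) (t : tup Y) : K :=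
  \sum_(r <- finsupp R | restr h r == t) R r.

Definition is_marg (Z X : {fset Att}) (W : krel Z) (R : krel X) : Prop :=
  exists h : X `<=` Z, forall t : tup X, marg W h t = R t.

Definition consistent (X Y : {fset Att}) (R : krel X) (S : krel Y) : Prop :=
  exists W : krel (X `|` Y), is_marg W R /\ is_marg W S.

Definition inner_consistent (X Y : {fset Att}) (R : krel X) (S : krel Y) : Prop :=
  forall t : tup (X `&` Y), marg R (fsubsetIl X Y) t = marg S (fsubsetIr X Y) t.

Definition inner_consistency_property : Prop :=
  forall (X Y : {fset Att}) (R : krel X) (S : krel Y),
    inner_consistent R S -> consistent R S.

(* A hypergraph given by its hyperedges X_0, ..., X_{m-1} *)
Definition pairwise_consistent m (X : 'I_m -> {fset Att})
  (R : forall i : 'I_m, krel (X i)) : Prop :=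
  forall i j : 'I_m, consistent (R i) (R j).

Definition globally_consistent m (X : 'I_m -> {fset Att})
  (R : forall i : 'I_m, krel (X i)) : Prop :=
  exists W : krel (\big[@fsetU _/fset0]_(i < m) X i), forall i : 'I_m, is_marg W (R i).

Definition local_to_global m (X : 'I_m -> {fset Att}) : Prop :=
  forall R : forall i : 'I_m, krel (X i),
    pairwise_consistent R -> globally_consistent R.

End Relations.

Definition is_tree m (E : rel 'I_m) : Prop :=
  symmetric E /\ irreflexive E /\
  (forall i j : 'I_m, connect E i j) /\
  (forall c : seq 'I_m, uniq c -> (3 <= size c)%N -> ~~ cycle E c).

Definition induced m (E : rel 'I_m) (S : pred 'I_m) : rel 'I_m :=
  [rel i j | [&& E i j, S i & S j]].

Definition join_tree (Att : choiceType) m (X : 'I_m -> {fset Att}) (E : rel 'I_m) : Prop :=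
  is_tree E /\
  forall v : Att, forall i j : 'I_m, v \in X i -> v \in X j ->
    connect (induced E [pred k | v \in X k]) i j.

Definition acyclic (Att : choiceType) m (X : 'I_m -> {fset Att}) : Prop :=
  exists E : rel 'I_m, join_tree X E.

Definition P3 (Att : choiceType) (A B C D : Att) : 'I_3 -> {fset Att} :=
  fun i => match val i with
           | 0 => [fset A; B]
           | 1 => [fset B; C]
           | _ => [fset C; D]
           end.

(* Main.v *)
Require Import Defs.
From HB Require Import structures.
From mathcomp Require Import all_boot all_order all_algebra.
From mathcomp Require Import finmap.

(** Transportation on each fibre over [X `&` Y] gives inner consistency.  Inner
    consistency lets a witness for a connected part of a join tree be extended
    along a tree edge [(i, j)], because the attributes that [X j] shares with the
    part all lie in [X i].  Conversely, a transportation instance [b], [c] is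
    encoded in three relations over the path [AB], [BC], [CD]: the tuples with
    [B = C = 0] carry the instance, and the tuples with [B = C = 1] carry its
    mirror image, which makes [AB] and [CD] consistent for free. *)

Set Implicit Arguments. Unset Strict Implicit. Unset Printing Implicit Defensive.
Import GRing.Theory.
Local Open Scope fset_scope.
Local Open Scope ring_scope.

(** * Transportation over finite types and along fibres *)

Lemma positive_sum_eq0 (K : nmodType) (I : eqType) (s : seq I) (P : pred I)
    (F : I -> K) :
  positive_monoid K -> \sum_(i <- s | P i) F i = 0 ->
  forall i, i \in s -> P i -> F i = 0.
Proof.
move=> Kpos sum0 i i_s Pi.
by move: sum0; rewrite (big_rem _ i_s) /= Pi => /Kpos[].
Qed.

Lemma transportation_fin (K : nmodType) (U V : finType) (A : pred U)
    (B : pred V) (b : U -> K) (c : V -> K) (u0 : U) (v0 : V) :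
  transportation_property K -> u0 \in A -> v0 \in B ->
  \sum_(u in A) b u = \sum_(v in B) c v ->
  exists d : U -> V -> K,
    (forall u, u \in A -> \sum_(v in B) d u v = b u) /\
    (forall v, v \in B -> \sum_(u in A) d u v = c v).
Proof.
move=> tp Au0 Bv0; rewrite big_enum_val [RHS]big_enum_val => eq_bc.
have gt0A : (0 < #|A|)%N by apply/card_gt0P; exists u0.
have gt0B : (0 < #|B|)%N by apply/card_gt0P; exists v0.
have [d [dr dc]] := tp _ _ gt0A gt0B _ _ eq_bc.
(* The ranks of points outside [A] and [B] are default values that the sums never see. *)
exists (fun u v => d (enum_rank_in Au0 u) (enum_rank_in Bv0 v)).
split=> [u Au | v Bv]; rewrite big_enum_val.
  under eq_bigr do rewrite enum_valK_in.
  by rewrite dr enum_rankK_in.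
under eq_bigr do rewrite enum_valK_in.
by rewrite dc enum_rankK_in.
Qed.

(** Distinct fibres do not interact, so each value [t] gives its own transportation instance.
    Positivity makes every fibre nonempty on both sides or on neither: otherwise a nonempty sum of
    nonzero weights would vanish. *)
Lemma transportation_fibered (K : nmodType) (U V : finType) (T : choiceType)
    (f : U -> T) (g : V -> T) (b : U -> K) (c : V -> K) :
  positive_monoid K -> transportation_property K ->
  (forall u, b u != 0) -> (forall v, c v != 0) ->
  (forall t, \sum_(u | f u == t) b u = \sum_(v | g v == t) c v) ->
  exists d : U -> V -> K,
    (forall u, \sum_(v | g v == f u) d u v = b u) /\
    (forall v, \sum_(u | f u == g v) d u v = c v).
Proof.
move=> Kpos tp bN0 cN0 eq_bc.
have ex_v u : exists v, g v == f u.
  apply/existsP; apply: contraNT (bN0 u) => /existsPn gN; apply/eqP.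
  have sum0 : \sum_(u' | f u' == f u) b u' = 0.
    by rewrite eq_bc big_pred0 // => v; apply: negbTE.
  exact: (positive_sum_eq0 Kpos sum0) (mem_index_enum _) (eqxx _).
have ex_u v : exists u, f u == g v.
  apply/existsP; apply: contraNT (cN0 v) => /existsPn fN; apply/eqP.
  have sum0 : \sum_(v' | g v' == g v) c v' = 0.
    by rewrite -eq_bc big_pred0 // => u; apply: negbTE.
  exact: (positive_sum_eq0 Kpos sum0) (mem_index_enum _) (eqxx _).
(* [T] may be infinite, but only the values of [f] matter; they form a finite set, so solutions of
   all the instances can be chosen at once. *)
pose F := [fset f u | u in U].
have /fin_all_exists[d dP] (x : F) : exists d : U -> V -> K,
    (forall u, f u == val x -> \sum_(v | g v == val x) d u v = b u) /\
    (forall v, g v == val x -> \sum_(u | f u == val x) d u v = c v).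
  have /imfsetP[/= u0 _ xE] := valP x; rewrite [fsval x]xE.
  have [v0 gv0] := ex_v u0.
  apply: (@transportation_fin _ _ _ [pred u | f u == f u0]
                              [pred v | g v == f u0] _ _ u0 v0 tp).
  - exact: eqxx.
  - exact: gv0.
  - exact: eq_bc.
have inF u : f u \in F by rewrite in_imfset.
exists (fun u v => d [` inF u] u v); split=> [u | v].
  by have [-> //] := dP [` inF u].
have [u0 /eqP fu0] := ex_u v.
have [_ <-] := dP [` inF u0]; last by rewrite /= fu0.
apply: eq_big => [u | u /eqP fu]; first by rewrite /= fu0.
by congr (d _ u v); apply: val_inj; rewrite /= fu fu0.
Qed.

(** * Gluing of tuples, marginals and inner consistency *)

Section KRelations.
Variables (Att : choiceType) (Dom : Att -> choiceType) (K : nmodType).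
Implicit Types X Y Z : {fset Att}.

Lemma tup_irrelevance X (t : tup Dom X) a (aX aX' : a \in X) :
  t [` aX] = t [` aX'].
Proof. by rewrite (bool_irrelevance aX aX'). Qed.

Lemma restr_trans X Y Z (h : Y `<=` X) (h' : Z `<=` Y) (h'' : Z `<=` X)
    (t : tup Dom X) :
  restr h' (restr h t) = restr h'' t.
Proof. by apply/ffunP => a; rewrite !ffunE; apply: tup_irrelevance. Qed.

Lemma tup_fincl X (h : X `<=` X) (t : tup Dom X) a : t (fincl h a) = t a.
Proof.
case: a => a aX; rewrite /fincl.
by rewrite (bool_irrelevance (fsubsetP _ _ _) aX).
Qed.

Lemma restr_id X (h : X `<=` X) (t : tup Dom X) : restr h t = t.
Proof. by apply/ffunP => a; rewrite ffunE; apply: tup_fincl. Qed.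

(** Values come from [r] on [X] and from [s] off [X]. Agreement guards only the second half, so a
    [w] exists for every pair and finite choice over all pairs applies. *)
Lemma restr_glue X Y (r : tup Dom X) (s : tup Dom Y) :
  exists w : tup Dom (X `|` Y),
    restr (fsubsetUl X Y) w = r /\
    (restr (fsubsetIl X Y) r = restr (fsubsetIr X Y) s ->
     restr (fsubsetUr X Y) w = s).
Proof.
pose agree := restr (fsubsetIl X Y) r = restr (fsubsetIr X Y) s.
pose P (a : X `|` Y) (x : Dom (val a)) :=
  (forall aX : val a \in X, x = r [` aX]) /\
  (agree -> forall aY : val a \in Y, x = s [` aY]).
have /fin_all_exists[w wP] a : exists x, P a x.
  have [aX | aNX] := boolP (val a \in X).
    exists (r [` aX]); split=> [aX' | /ffunP rs aY].
      exact: tup_irrelevance.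
    have aI : val a \in X `&` Y by rewrite inE aX.
    have := rs [` aI]; rewrite !ffunE => rsa.
    transitivity (r (fincl (fsubsetIl X Y) [` aI])).
      exact: tup_irrelevance.
    by rewrite rsa; apply: tup_irrelevance.
  have aY : val a \in Y by have := valP a; rewrite inE (negbTE aNX).
  exists (s [` aY]); split=> [aX | _ aY']; first by case/negP: aNX.
  exact: tup_irrelevance.
exists (finfun w); split=> [| rs]; apply/ffunP => -[a aP]; rewrite !ffunE.
  by have [/(_ aP)] := wP (fincl (fsubsetUl X Y) [` aP]).
by have [_ /(_ rs aP)] := wP (fincl (fsubsetUr X Y) [` aP]).
Qed.

(* The push-forward to [tup Dom X] of the finite weighted family [k]. *)
Definition family_krel X (I : finType) (w : I -> tup Dom X) (k : I -> K) :
    krel Dom K X :=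
  [fsfun t in [fset w i | i in I] => \sum_(i | w i == t) k i].

Lemma family_krelE X (I : finType) (w : I -> tup Dom X) (k : I -> K) t :
  family_krel w k t = \sum_(i | w i == t) k i.
Proof.
rewrite fsfunE; case: ifPn => // tN; rewrite big_pred0 // => i.
by apply: contraNF tN => /eqP<-; rewrite in_imfset.
Qed.

Lemma marg_family_krel X Y (I : finType) (w : I -> tup Dom X) (k : I -> K)
    (h : Y `<=` X) t :
  marg (family_krel w k) h t = \sum_(i | restr h (w i) == t) k i.
Proof.
pose F := [fset w i | i in I].
(* The support can be smaller than the image [F], since the weights over a tuple may sum to 0; the
   sum is extended to [F] before the exchange. *)
have sub : finsupp (family_krel w k) `<=` F by apply: finsupp_sub.
rewrite /marg big_mkcond (big_fset_incl _ sub) => [|r _]; last first.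
  by rewrite memNfinsupp => /eqP->; rewrite if_same.
rewrite -big_mkcond.
under eq_bigr do rewrite family_krelE.
rewrite (exchange_big_dep (fun i => restr h (w i) == t)) /=; last first.
  by move=> r i /eqP<- /eqP->.
apply: eq_bigr => i hi; rewrite -big_filter.
rewrite (_ : [seq _ <- _ | _] = [:: w i]) ?big_seq1 //.
rewrite (@eq_filter _ _ (pred1 (w i))) => [|r /=]; last first.
  by rewrite andbC [w i == r]eq_sym; case: eqP => //= ->.
by rewrite filter_pred1_uniq ?fset_uniq ?in_imfset.
Qed.

Lemma margE X Y (W : krel Dom K X) (h : Y `<=` X) t :
  marg W h t = \sum_(i : finsupp W | restr h (val i) == t) W (val i).
Proof. by rewrite /marg big_seq_fsetE. Qed.

(** [marg] is a bare function; a push-forward indexed by the support of [W] makes it a relation with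
    finite support. *)
Definition marg_krel X Y (W : krel Dom K X) (h : Y `<=` X) : krel Dom K Y :=
  family_krel (fun i : finsupp W => restr h (val i)) (fun i => W (val i)).

Lemma is_marg_marg_krel X Y (W : krel Dom K X) (h : Y `<=` X) :
  is_marg W (marg_krel W h).
Proof. by exists h => t; rewrite family_krelE margE. Qed.

Lemma marg_trans X Y Z (W : krel Dom K X) (R : krel Dom K Y)
    (h : Z `<=` Y) (h' : Z `<=` X) t :
  is_marg W R -> marg R h t = marg W h' t.
Proof.
case=> hY WR.
have -> : R = marg_krel W hY.
  by apply/fsfunP => s; rewrite family_krelE -WR margE.
rewrite marg_family_krel margE.
by apply: eq_bigl => i; rewrite (restr_trans _ _ h').
Qed.

Lemma is_marg_trans X Y Z (W : krel Dom K X) (R : krel Dom K Y)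
    (S : krel Dom K Z) :
  is_marg W R -> is_marg R S -> is_marg W S.
Proof.
move=> WR [h RS]; have [hY _] := WR.
exists (fsubset_trans h hY) => t.
by rewrite -RS (marg_trans h (fsubset_trans h hY) t WR).
Qed.

Lemma krelE X (W : krel Dom K X) t :
  W t = \sum_(i : finsupp W | val i == t) W (val i).
Proof.
rewrite -(big_seq_fsetE _ _ (pred1 t)) -big_filter.
have [tW | tNW] := boolP (t \in finsupp W).
  by rewrite filter_pred1_uniq ?fset_uniq // big_seq1.
rewrite big_filter big_seq_cond big_pred0 => [|r].
  by apply/eqP; rewrite -memNfinsupp.
by apply/negbTE; apply: contra tNW => /andP[? /eqP<-].
Qed.

Lemma is_marg_refl X (W : krel Dom K X) : is_marg W W.
Proof.
exists (fsubset_refl X) => t; rewrite margE [RHS]krelE.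
by apply: eq_bigl => i; rewrite restr_id.
Qed.

(** Serves to read row and column sums off a marginal. The family [s] must cover the support of [W]
    over [t]; it may also contain tuples outside the support, whose weight is 0. *)
Lemma sum_marg X Y (W : krel Dom K X) (h : Y `<=` X) t (J : finType)
    (s : J -> tup Dom X) :
  injective s -> (forall j, restr h (s j) = t) ->
  (forall w, W w != 0 -> restr h w = t -> exists j, w = s j) ->
  \sum_j W (s j) = marg W h t.
Proof.
move=> s_inj hs sW.
under eq_bigr do rewrite krelE.
rewrite margE (exchange_big_dep (fun w => restr h (val w) == t)) /=; last first.
  by move=> j w _ /eqP->; rewrite hs.
apply: eq_bigr => w /eqP hw.
have [|j wj] := sW (val w) _ hw; first by rewrite -mem_finsupp; apply: valP.
rewrite (big_pred1 j) // => j' /=.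
by rewrite [fsval w]wj (inj_eq s_inj) eq_sym.
Qed.

Lemma marg_neq0 X Y (W : krel Dom K X) (h : Y `<=` X) w :
  positive_monoid K -> W w != 0 -> marg W h (restr h w) != 0.
Proof.
move=> Kpos; apply: contraNneq => sum0.
have [wW | /[!memNfinsupp]/eqP//] := boolP (w \in finsupp W).
by apply/eqP; apply: (positive_sum_eq0 Kpos sum0 wW); rewrite eqxx.
Qed.

Lemma is_marg_krel_sub X Y Z (W : krel Dom K X) (R : krel Dom K Z)
    (h : Y `<=` X) :
  Z `<=` Y -> is_marg W R -> is_marg (marg_krel W h) R.
Proof.
move=> ZY [hZ WR]; exists ZY => t.
by rewrite -WR (marg_trans ZY hZ t (is_marg_marg_krel W h)).
Qed.

(** A witness over any larger attribute set suffices, because its marginal on [X] and [Y] together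
    is again a witness. *)
Lemma consistent_of_common X Y Z (W : krel Dom K Z) (R : krel Dom K X)
    (S : krel Dom K Y) :
  is_marg W R -> is_marg W S -> consistent R S.
Proof.
move=> WR WS; have [hX _] := WR; have [hY _] := WS.
have hXY : X `|` Y `<=` Z by rewrite fsubUset hX.
exists (marg_krel W hXY); split; apply: is_marg_krel_sub => //.
  exact: fsubsetUl.
exact: fsubsetUr.
Qed.

Lemma consistent_marg X Y Z (R : krel Dom K X) (S : krel Dom K Y)
    (hX : Z `<=` X) (hY : Z `<=` Y) t :
  consistent R S -> marg R hX t = marg S hY t.
Proof.
case=> W [WR WS].
have hZ : Z `<=` X `|` Y := fsubset_trans hX (fsubsetUl X Y).
by rewrite (marg_trans hX hZ t WR) (marg_trans hY hZ t WS).
Qed.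

Lemma inner_consistency_of_transportation :
  positive_monoid K -> transportation_property K ->
  inner_consistency_property Dom K.
Proof.
move=> Kpos tp X Y R S RS.
pose f (u : finsupp R) := restr (fsubsetIl X Y) (val u).
pose g (v : finsupp S) := restr (fsubsetIr X Y) (val v).
have [|||d [dr dc]] := @transportation_fibered K _ _ _ f g
    (fun u => R (val u)) (fun v => S (val v)) Kpos tp.
- by move=> u; rewrite -mem_finsupp; apply: valP.
- by move=> v; rewrite -mem_finsupp; apply: valP.
- by move=> t; have := RS t; rewrite !margE.
have /fin_all_exists[w wP] (p : finsupp R * finsupp S) :
    exists w : tup Dom (X `|` Y), restr (fsubsetUl X Y) w = val p.1 /\
      (f p.1 = g p.2 -> restr (fsubsetUr X Y) w = val p.2).
  exact: restr_glue.
(* For a pair that disagrees on the common attributes, the glued tuple need not restrict to the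
   second component, so its weight is 0. *)
pose k (p : finsupp R * finsupp S) := if g p.2 == f p.1 then d p.1 p.2 else 0.
have [hR RR] := is_marg_refl R; have [hS SS] := is_marg_refl S.
exists (family_krel w k); split.
  exists (fsubsetUl X Y) => t; rewrite marg_family_krel -RR margE.
  under [RHS]eq_bigr => u _ do rewrite -dr big_mkcond.
  rewrite pair_big_dep /=; apply: eq_big => [p | p _] //=.
  by have [-> _] := wP p; rewrite andbT restr_id.
exists (fsubsetUr X Y) => t; rewrite marg_family_krel -SS margE.
under [RHS]eq_bigr => v _ do rewrite -dc big_mkcond.
rewrite (exchange_big_dep predT) //= pair_big_dep /=.
rewrite big_mkcond [RHS]big_mkcond; apply: eq_bigr => p _ /=.
rewrite /k [g _ == _]eq_sym restr_id andbT.
have [fg|_] := eqVneq (f p.1) (g p.2); last by rewrite !if_same.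
by have [_ /(_ fg)->] := wP p.
Qed.

End KRelations.

(** * Separation by an edge of a join tree *)

Lemma tree_edge_separates m (E : rel 'I_m) (i j : 'I_m) :
  is_tree E -> E i j ->
  ~~ connect [rel x y | E x y && ((x, y) \notin [:: (i, j); (j, i)])] j i.
Proof.
case=> _ [irrE [_ acycE]] Eij; apply/negP => /connectP[p pE iE].
case/shortenP: pE iE => q qE uq _ iE.
(* A simple path from [j] to [i] closes up with the edge into a cycle. It has at least three
   vertices: [i = j] contradicts irreflexivity, and a one-step path would use the removed edge. *)
have /negP[] : ~~ cycle E (j :: q).
  apply: acycE => //; case: q qE uq iE => [|x [|y q]] //=.
    by move=> _ _ ij; rewrite ij irrE in Eij.
  by rewrite andbT => /andP[_ +] _ xi; rewrite -xi !inE eqxx orbT.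
rewrite /= rcons_path -iE Eij andbT.
by apply: sub_path qE => x y /andP[].
Qed.

Lemma connect_crossing (T : finType) (e : rel T) (S : {set T}) (x y : T) :
  connect e x y -> x \in S -> y \notin S ->
  exists i j, [/\ i \in S, j \notin S & e i j].
Proof.
case/connectP=> p; elim: p x => [|z p IHp] x /=.
  by move=> _ -> ->.
case/andP=> exz pE yE xS yNS.
have [zS | zNS] := boolP (z \in S); first exact: (IHp z).
by exists x, z.
Qed.

(** If [v] were not in [X i], the subtree of [v] would link [j] to [k] while avoiding [i], and [T]
    would link [k] to [i] while avoiding [j]. Neither uses the edge between [i] and [j], whose
    removal separates its ends. *)
Lemma join_tree_separates (Att : choiceType) m (X : 'I_m -> {fset Att})
    (E : rel 'I_m) (T : {set 'I_m}) (i j k : 'I_m) v :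
  join_tree X E ->
  {in T &, forall x y, connect (induced E (mem T)) x y} ->
  i \in T -> j \notin T -> E i j -> k \in T ->
  v \in X k -> v \in X j -> v \in X i.
Proof.
move=> [treeE runE] connT iT jNT Eij kT vk vj.
apply: contraT => vNi; case/negP: (tree_edge_separates treeE Eij).
apply: (connect_trans (y := k)).
  apply: connect_sub (runE v j k vj vk) => x y /and3P[Exy /= vx vy].
  apply: connect1; rewrite /= Exy !inE !xpair_eqE.
  by apply: contra vNi => /orP[/andP[/eqP<-] | /andP[_ /eqP<-]].
apply: connect_sub (connT k i kT iT) => x y /and3P[Exy /= xT yT].
apply: connect1; rewrite /= Exy !inE !xpair_eqE.
by apply: contra jNT => /orP[/andP[_ /eqP<-] | /andP[/eqP<-]].
Qed.

(** * Growing a joint witness along the join tree *)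

Section Growth.
Variables (Att : choiceType) (Dom : Att -> choiceType) (K : nmodType).
Variables (m : nat) (X : 'I_m -> {fset Att}) (R : forall i, krel Dom K (X i)).

(** The type of [W] depends on its attribute set; describing [Y] only by its members avoids casts
    when [T] grows. *)
Definition jointly_consistent (T : {set 'I_m}) : Prop :=
  exists (Y : {fset Att}) (W : krel Dom K Y),
    (forall v, v \in Y <-> exists2 k, k \in T & v \in X k) /\
    (forall k, k \in T -> is_marg W (R k)).

Lemma jointly_consistent_setU1 (E : rel 'I_m) (T : {set 'I_m}) (i j : 'I_m) :
  inner_consistency_property Dom K -> pairwise_consistent R ->
  join_tree X E -> {in T &, forall x y, connect (induced E (mem T)) x y} ->
  i \in T -> j \notin T -> E i j ->
  jointly_consistent T -> jointly_consistent (j |: T).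
Proof.
move=> icp pwR jtE connT iT jNT Eij [Y [W [YP WR]]].
have hYi : Y `&` X j `<=` X i.
  apply/fsubsetP => v; rewrite inE => /andP[/YP[k kT vk] vj].
  exact: join_tree_separates jtE connT iT jNT Eij kT vk vj.
have [W' [W'W W'R]] : consistent W (R j).
  apply: icp => t.
  (* On the shared attributes, the marginal of [W] is that of [R i], which is consistent with
     [R j]. *)
  rewrite -(marg_trans hYi (fsubsetIl Y (X j)) t (WR i iT)).
  exact: consistent_marg.
exists (Y `|` X j), W'; split=> [v | k /setU1P[-> // | kT]]; last first.
  exact: is_marg_trans W'W (WR k kT).
split=> [/fsetUP[/YP[k kT vk] | vj] | [k /setU1P[->|kT] vk]]; last 2 first.
- by apply/fsetUP; right.
- by apply/fsetUP; left; apply/YP; exists k.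
- by exists k => //; rewrite setU1r.
- by exists j => //; rewrite setU11.
Qed.

Lemma connected_setU1 (E : rel 'I_m) (T : {set 'I_m}) (i j : 'I_m) :
  symmetric E -> {in T &, forall x y, connect (induced E (mem T)) x y} ->
  i \in T -> E i j ->
  {in j |: T &, forall x y, connect (induced E (mem (j |: T))) x y}.
Proof.
move=> symE connT iT Eij.
have iU : i \in j |: T by rewrite setU1r.
have connU x : x \in j |: T -> connect (induced E (mem (j |: T))) i x.
  case/setU1P=> [->|xT].
    by apply: connect1; rewrite /induced /= Eij iU setU11.
  apply: connect_sub (connT i x iT xT) => y z /and3P[Eyz /= yT zT].
  by apply: connect1; rewrite /induced /= Eyz !setU1r.
have symU : connect_sym (induced E (mem (j |: T))).
  apply: sym_connect_sym => x y.
  by rewrite /induced /= symE; congr (_ && _); rewrite andbC.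
move=> x y xU yU; apply: (connect_trans (y := i)); last exact: connU.
by rewrite symU; apply: connU.
Qed.

Lemma join_tree_local_to_global :
  inner_consistency_property Dom K -> acyclic X -> pairwise_consistent R ->
  globally_consistent R.
Proof.
move=> icp [E jtE] pwR; have [[symE [_ [connE _]]] _] := jtE.
suff [Y [W [YP WR]]] : jointly_consistent setT.
  have YE : Y = \big[@fsetU _/fset0]_(i < m) X i.
    apply/fsetP => v; apply/idP/bigfcupP => [/YP[k _ vk] | [k _ vk]].
      by exists k; rewrite ?mem_index_enum.
    by apply/YP; exists k; rewrite ?inE.
  by subst Y; exists W => i; apply: WR; rewrite inE.
(* Without hyperedges there is no vertex to start from, and the empty relation is a vacuous
   witness. *)
case: (posnP m) => [m0 | m_gt0].
  have noord (i : 'I_m) : False by case: i; rewrite m0.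
  exists fset0, [fsfun]; split=> [v | k]; last by case: (noord k).
  by rewrite in_fset0; split=> // -[k]; case: (noord k).
(* A connected set of [n.+1] vertices grows by one across an edge leaving it; at [n = m.-1] it is
   everything. *)
suff /(_ m.-1)[|T [cardT _]] : forall n, (n < m)%N -> exists T : {set 'I_m},
    [/\ #|T| = n.+1, {in T &, forall x y, connect (induced E (mem T)) x y}
      & jointly_consistent T].
- by rewrite ltn_predL.
- suff -> : T = setT by [].
  by apply/eqP; rewrite eqEcard subsetT cardsT card_ord cardT prednK ?leqnn.
elim=> [_ | n IHn ltn].
  exists [set Ordinal m_gt0]; split; first exact: cards1.
    by move=> x y /set1P-> /set1P->; apply: connect0.
  exists (X (Ordinal m_gt0)), (R (Ordinal m_gt0)); split=> [v | k /set1P->].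
    split=> [v0 | [k /set1P->] //].
    by exists (Ordinal m_gt0); rewrite ?set11.
  exact: is_marg_refl.
have [T [cardT connT jcT]] := IHn (ltnW ltn).
have [x xT] : exists x, x \in T by apply/card_gt0P; rewrite cardT.
have [y] : exists y, y \in ~: T.
  by apply/card_gt0P; rewrite cardsCs setCK card_ord cardT subn_gt0.
rewrite inE => yNT.
have [i [j [iT jNT Eij]]] := connect_crossing (connE x y) xT yNT.
exists (j |: T); split; first by rewrite cardsU1 jNT cardT.
  exact: connected_setU1 connT iT Eij.
exact: jointly_consistent_setU1 connT iT jNT Eij jcT.
Qed.

End Growth.

(** * The path as its own join tree *)

Lemma P3_acyclic (Att : choiceType) (A B C D : Att) :
  uniq [:: A; B; C; D] -> acyclic (P3 A B C D).
Proof.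
move=> uABCD.
pose E := [rel i j : 'I_3 | (i.+1 == j :> nat) || (j.+1 == i :> nat)].
have symE : symmetric E by move=> i j; rewrite /= orbC.
(* The middle hyperedge is adjacent to both others, so it links the only distinct non-adjacent
   pair. *)
pose i1 : 'I_3 := Ordinal (isT : (1 < 3)%N).
have viaE (i j : 'I_3) : i != j -> ~~ E i j -> E i i1 && E i1 j.
  by case: i j => [[|[|[|i]]] hi] [[|[|[|j]]] hj].
have connE (S : pred 'I_3) i j : S i -> S j -> [|| i == j, E i j | S i1] ->
    connect (induced E S) i j.
  move=> Si Sj; have [-> | Nij] /= := eqVneq i j; first by rewrite connect0.
  have [Eij _ | NEij] := boolP (E i j); first by apply: connect1; apply/and3P.
  rewrite -[X in X || _]/(E i j) (negbTE NEij) /= => Si1.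
  have /andP[Ei1 E1j] := viaE i j Nij NEij.
  by apply: (connect_trans (y := i1)); apply: connect1; apply/and3P.
exists E; split; first split=> //.
  split=> [[[|[|[|i]]] hi] //|]; split=> [i j | c uc c3].
    apply: (connect_sub (e := induced E predT)); last by rewrite connE ?orbT.
    by move=> x y /and3P[Exy _ _]; apply: connect1.
  (* A cycle would run through all three indices, but the two outer ones are not adjacent. *)
  have: (size c <= 3)%N by rewrite -(card_uniqP uc) (leq_trans (max_card _)) ?card_ord.
  case: c c3 {uc} => [|x [|y [|z [|? ?]]]] // _ _ /=; rewrite andbT.
  by case: x y z => [[|[|[|x]]] hx] [[|[|[|y]]] hy] [[|[|[|z]]] hz].
move: uABCD; rewrite /= !inE !negb_or -!andbA.
case/and5P=> _ AC AD BC /andP[BD _].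
move=> v i j vi vj; apply: connE => //=.
(* Only the two outer hyperedges remain, and they are disjoint. *)
case: i j vi vj => [[|[|[|i]]] hi] [[|[|[|j]]] hj] //=; rewrite !inE //= => vi vj.
  by move: vj; case/orP: vi => /eqP->;
    rewrite ?(negbTE AC) ?(negbTE AD) ?(negbTE BC) ?(negbTE BD).
by move: vi; case/orP: vj => /eqP->;
  rewrite ?(negbTE AC) ?(negbTE AD) ?(negbTE BC) ?(negbTE BD).
Qed.

(** * From the path to transportation *)

Definition nat_dom (_ : nat) : choiceType := nat.

Section NatTuples.
Variable K : nmodType.

(** Presenting tuples by total functions makes restriction invisible: only the index [X] changes. *)
Definition nat_tup (X : {fset nat}) (f : nat -> nat) : tup nat_dom X :=
  [ffun a => f (val a)].

Lemma restr_nat_tup X Y (h : Y `<=` X) f : restr h (nat_tup X f) = nat_tup Y f.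
Proof. by apply/ffunP => a; rewrite !ffunE. Qed.

Lemma eq_nat_tup X f g : {in X, f =1 g} -> nat_tup X f = nat_tup X g.
Proof. by move=> fg; apply/ffunP => a; rewrite !ffunE; apply: fg; apply: valP. Qed.

Lemma nat_tup_eq2 p q f g :
  (nat_tup [fset p; q] f == nat_tup [fset p; q] g) =
  (f p == g p) && (f q == g q).
Proof.
apply/eqP/andP => [/ffunP fg | [/eqP fgp /eqP fgq]].
  have pX : p \in [fset p; q] by rewrite !inE eqxx.
  have qX : q \in [fset p; q] by rewrite !inE eqxx orbT.
  by have := fg [` pX]; have := fg [` qX]; rewrite !ffunE /= => -> ->.
by apply: eq_nat_tup => a; rewrite !inE => /orP[] /eqP->.
Qed.

Lemma nat_tup_surj X (w : tup nat_dom X) : exists f, w = nat_tup X f.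
Proof.
exists (fun a => if insub a is Some aX then w aX else 0%N).
by apply/ffunP => a; rewrite ffunE valK.
Qed.

Definition nat_krel X (I : finType) (f : I -> nat -> nat) (k : I -> K) :
    krel nat_dom K X :=
  family_krel (fun i => nat_tup X (f i)) k.

Lemma sum_nat_tup_const X (I : finType) (f : I -> nat -> nat) (k : I -> K) g t :
  (forall i, nat_tup X (f i) = nat_tup X g) ->
  \sum_(i | nat_tup X (f i) == t) k i =
  if nat_tup X g == t then \sum_i k i else 0.
Proof.
move=> fg; under eq_bigl do rewrite fg.
by case: ifP => // _; apply: big_pred0.
Qed.

Lemma is_marg_nat_krel X Y (I : finType) (f : I -> nat -> nat) (k : I -> K) :
  Y `<=` X -> is_marg (nat_krel X f k) (nat_krel Y f k).
Proof.
move=> h; exists h => t; rewrite marg_family_krel family_krelE.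
by apply: eq_bigl => i; rewrite restr_nat_tup.
Qed.

Lemma nat_krel_neq0 X (I : finType) (f : I -> nat -> nat) (k : I -> K) t :
  nat_krel X f k t != 0 -> exists i, nat_tup X (f i) == t.
Proof.
rewrite family_krelE => sumN0; apply/existsP.
apply: contraNT sumN0 => /existsPn fN; rewrite big_pred0 // => i.
exact: negbTE.
Qed.

(** The attributes A, B, C, D are 0, 1, 2, 3, and domains equal to [nat] let the indices of [b] and
    [c] serve as values. The solution is the part of a global witness with B = C = 0. *)
Lemma transportation_of_P3 :
  positive_monoid K -> local_to_global nat_dom K (P3 0 1 2 3)%N ->
  transportation_property K.
Proof.
move=> Kpos ltg m n _ _ b c eq_bc.
pose P := (P3 0 1 2 3)%N.
pose Z := \big[@fsetU _/fset0]_(i < 3) P i.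
have PZ i : P i `<=` Z by apply: bigfcup_sup; rewrite ?mem_index_enum.
pose v x y z t (a : nat) := nth 0%N [:: x; y; z; t] a.
pose k (x : 'I_m + 'I_n) := match x with inl i => b i | inr j => c j end.
(* Each of the three families, weighted by [k], is a common witness for the two relations named by
   its digits. Here each index is copied to both A and D, so [b] is matched with [b] and [c] with
   [c]. *)
pose f02 (x : 'I_m + 'I_n) :=
  match x with inl i => v i 0 1 i | inr j => v j 1 0 j end%N.
pose f01 (x : 'I_m + 'I_n) :=
  match x with inl i => v i 0 0 0 | inr j => v j 1 1 0 end%N.
pose f12 (x : 'I_m + 'I_n) :=
  match x with inl i => v 0 1 1 i | inr j => v 0 0 0 j end%N.
pose f (i : 'I_3) := if i == 1 :> nat then f01 else f02.
pose R i := nat_krel (P i) (f i) k.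
have eqR i g : (forall x, nat_tup (P i) (g x) = nat_tup (P i) (f i x)) ->
    is_marg (nat_krel Z g k) (R i).
  move=> eg; suff -> : R i = nat_krel (P i) g k by apply: is_marg_nat_krel.
  by apply/fsfunP => t; rewrite !family_krelE; apply: eq_bigl => x; rewrite eg.
have R02 (i : 'I_3) : i != 1 :> nat -> is_marg (nat_krel Z f02 k) (R i).
  by move=> iN1; apply: eqR => x; rewrite /f (negbTE iN1).
have R01 (i : 'I_3) : i != 2 :> nat -> is_marg (nat_krel Z f01 k) (R i).
  case: i => [[|[|[|i]]] hi] // _; apply: eqR => x //; apply/eqP.
  by rewrite nat_tup_eq2; case: x => x; rewrite !eqxx.
have R12 (i : 'I_3) : i != 0 :> nat -> is_marg (nat_krel Z f12 k) (R i).
  case: i => [[|[|[|i]]] hi] // _; last first.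
    apply: eqR => x; apply/eqP.
    by rewrite nat_tup_eq2; case: x => x; rewrite !eqxx.
  set o := Ordinal hi.
  (* On BC, [f12] exchanges the places of [b] and [c], so the families differ tuple by tuple; only
     the masses at (0,0) and (1,1) agree, by [eq_bc]. *)
  suff -> : R o = nat_krel (P o) f12 k by apply: is_marg_nat_krel.
  apply/fsfunP => t; rewrite !family_krelE !big_sumType /=.
  have constP x y z y' z' : nat_tup (P o) (v y x x z) =
      nat_tup (P o) (v y' x x z').
    by apply/eqP; rewrite nat_tup_eq2 !eqxx.
  rewrite (sum_nat_tup_const _ (g := v 0 0 0 0)%N); last by move=> x; apply: constP.
  rewrite (sum_nat_tup_const _ (g := v 0 1 1 0)%N); last by move=> x; apply: constP.
  rewrite (sum_nat_tup_const _ (g := v 0 1 1 0)%N); last by move=> x; apply: constP.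
  rewrite (sum_nat_tup_const _ (g := v 0 0 0 0)%N); last by move=> x; apply: constP.
  by rewrite eq_bc addrC.
have [|W WR] := ltg R.
  (* Two indices, equal or not, always miss one of 0, 1, 2, and the family for the other two values
     applies. *)
  move=> i j; have [/andP[] | N1] := boolP ((i != 1 :> nat) && (j != 1 :> nat)).
    by move=> /R02 ? /R02; apply: consistent_of_common.
  have [/andP[] | N2] := boolP ((i != 2 :> nat) && (j != 2 :> nat)).
    by move=> /R01 ? /R01; apply: consistent_of_common.
  have /andP[] : (i != 0 :> nat) && (j != 0 :> nat).
    by case: i j N1 N2 => [[|[|[|i]]] hi] [[|[|[|j]]] hj].
  by move=> /R12 ? /R12; apply: consistent_of_common.
pose i0 : 'I_3 := Ordinal (isT : (0 < 3)%N).
pose i1 : 'I_3 := Ordinal (isT : (1 < 3)%N).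
pose i2 : 'I_3 := Ordinal (isT : (2 < 3)%N).
pose s (i : 'I_m) (j : 'I_n) := nat_tup Z (v i 0 0 j)%N.
(* By positivity, the support of [W] restricts into that of each [R i]. The middle relation forces B
   = C, hence both are 0; then A is an index of [b] and D an index of [c]. *)
have suppW g : W (nat_tup Z g) != 0 -> (g 1 == 0)%N || (g 2 == 0)%N ->
    exists i j, [/\ nat_tup Z g = s i j, g 0 = i & g 3 = j]%N.
  move=> Wg g120.
  have ex i : exists x, nat_tup (P i) (f i x) == nat_tup (P i) g.
    have [h hR] := WR i; have := marg_neq0 h Kpos Wg.
    by rewrite hR restr_nat_tup; apply: nat_krel_neq0.
  have [x0] := ex i0; have [x1] := ex i1; have [x2] := ex i2.
  rewrite !nat_tup_eq2 /f /=.
  case: x1 => x1 /andP[/eqP g2 /eqP g3] /andP[/eqP g1 /eqP g2']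
    /andP[/eqP g0 /eqP g1'];
    rewrite -g1 -g2' //= in g120 g2 g1'.
  case: x0 g0 g1' => // i g0 _; case: x2 g2 g3 => // j _ g3.
  exists i, j; split; rewrite -?g0 -?g3 //; apply: eq_nat_tup => a.
  by case/bigfcupP=> -[[|[|[|l]]] hl] _ //; rewrite !inE => /orP[]/eqP->.
have [h0 hR0] := WR i0; have [h2 hR2] := WR i2.
have s_eq i j i' j' : s i j = s i' j' -> i = i' /\ j = j'.
  move=> ss; have /eqP := congr1 (restr h0) ss; have /eqP := congr1 (restr h2) ss.
  rewrite !restr_nat_tup !nat_tup_eq2 => /andP[_ /eqP jj] /andP[/eqP ii _].
  by split; apply: val_inj.
(* Row sums are marginals on AB at (i,0), and column sums are marginals on CD at (0,j). *)
exists (fun i j => W (s i j)); split=> [i | j].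
  rewrite (sum_marg (h := h0) (t := nat_tup (P i0) (v i 0 0 0)%N)).
  - rewrite hR0 family_krelE big_sumType /=.
    rewrite (big_pred1 i) ?big_pred0 ?addr0 // => x; rewrite nat_tup_eq2 /=.
      by rewrite andbF.
    by rewrite andbT.
  - by move=> j j' /s_eq[].
  - by move=> j; rewrite restr_nat_tup; apply/eqP; rewrite nat_tup_eq2 !eqxx.
  - move=> w; have [g ->] := nat_tup_surj w => Wg /eqP.
    rewrite restr_nat_tup nat_tup_eq2 => /andP[/eqP g0 /eqP g1].
    have [|i' [j [-> gi _]]] := suppW g Wg; first by rewrite g1.
    by exists j; congr (s _ j); apply: val_inj; rewrite /= -gi g0.
rewrite (sum_marg (h := h2) (t := nat_tup (P i2) (v 0 0 0 j)%N)).
- rewrite hR2 family_krelE big_sumType /=.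
  by rewrite (big_pred1 j) ?big_pred0 ?add0r // => x; rewrite nat_tup_eq2.
- by move=> i i' /s_eq[].
- by move=> i; rewrite restr_nat_tup; apply/eqP; rewrite nat_tup_eq2 !eqxx.
- move=> w; have [g ->] := nat_tup_surj w => Wg /eqP.
  rewrite restr_nat_tup nat_tup_eq2 => /andP[/eqP g2 /eqP g3].
  have [|i [j' [-> _ gj]]] := suppW g Wg; first by rewrite g2 orbT.
  by exists i; congr (s i _); apply: val_inj; rewrite /= -gj g3.
Qed.

End NatTuples.

Theorem theorem17 (K : nmodType) (Kpos : positive_monoid K)
  (Knt : nontrivial_monoid K) :
  [<-> transportation_property K;
       forall (Att : choiceType) (Dom : Att -> choiceType),
         inner_consistency_property Dom K;
       forall (Att : choiceType) (Dom : Att -> choiceType)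
              (m : nat) (X : 'I_m -> {fset Att}),
         acyclic X -> local_to_global Dom K X;
       forall (Att : choiceType) (Dom : Att -> choiceType) (A B C D : Att),
         uniq [:: A; B; C; D] -> local_to_global Dom K (P3 A B C D)].
Proof.
split=> [tp Att Dom|]; first exact: inner_consistency_of_transportation.
split=> [icp Att Dom m X acycX R|]; first exact: join_tree_local_to_global.
split=> [ltg Att Dom A B C D uABCD | ltg].
  by apply: ltg; apply: P3_acyclic.
by apply: transportation_of_P3 => //; apply: ltg.
Qed.
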